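(* Let $n\geq 3$ be an integer. The exponents $\bar{\varphi}_1,\ldots,\bar{\varphi}_n$ are algebraically independent: there is no nonzero polynomial $R\in\mathbb{R}[X_1,\ldots,X_n]$ such that $R\big(\bar{\varphi}_1(\boldsymbol{u}),\ldots,\bar{\varphi}_n(\boldsymbol{u})\big)=0$ for every unit vector $\boldsymbol{u}\in\mathbb{R}^{n+1}$.
   Context: For $\boldsymbol{u}=(u_0,\ldots,u_n)\in\mathbb{R}^{n+1}$ with Euclidean norm $\|\boldsymbol{u}\|_2=1$ and a real $Q\geq 1$, let $\mathcal{C}_{\boldsymbol{u}}(Q)=\{\boldsymbol{x}\in\mathbb{R}^{n+1} : \|\boldsymbol{x}\|_2\leq 1,\ |\boldsymbol{x}\cdot\boldsymbol{u}|\leq Q^{-1}\}$, and for $1\leq d\leq n+1$ let $\lambda_d(\mathcal{C}_{\boldsymbol{u}}(Q))$ be the $d$-th successive minimum of this convex body with respect to the lattice $\mathbb{Z}^{n+1}$. For $q\geq 0$ set $L_{\boldsymbol{u},d}(q)=\log\lambda_d(\mathcal{C}_{\boldsymbol{u}}(e^q))$, and define $\bar{\varphi}_d(\boldsymbol{u})=\limsup_{q\to\infty} L_{\boldsymbol{u},d}(q)/q$. *)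

(* Defs.v *)
From HB Require Import structures.
From mathcomp Require Import all_boot all_order all_algebra.
From mathcomp Require Import all_classical all_reals all_analysis.

Set Implicit Arguments.
Unset Strict Implicit.
Unset Printing Implicit Defensive.

Import Order.TTheory GRing.Theory Num.Theory.
Import numFieldNormedType.Exports.

Local Open Scope classical_set_scope.
Local Open Scope ring_scope.

Definition dotr (R : realType) (m : nat) (x y : 'rV[R]_m) : R :=
  \sum_(i < m) x 0 i * y 0 i.

(* The norm `|x| of the library on row vectors is the sup norm. *)
Definition norm2 (R : realType) (m : nat) (x : 'rV[R]_m) : R :=
  Num.sqrt (dotr x x).

Definition body (R : realType) (m : nat) (u : 'rV[R]_m) (Q : R) :
    set 'rV[R]_m :=
  [set x | norm2 x <= 1 /\ `|dotr x u| <= Q^-1].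

(* Successive minima with respect to the lattice Z^m: the rows of the integer
   matrix A are d lattice points, and row_free states that they are linearly
   independent over R. Here d is counted from 1. *)
Definition succ_min (R : realType) (m : nat) (C : set 'rV[R]_m) (d : nat) : R :=
  inf [set l : R | 0 < l /\
    exists A : 'M[int]_(d, m),
      row_free (map_mx intr A : 'M[R]_(d, m)) /\
      forall i : 'I_d, [set l *: x | x in C] (row i (map_mx intr A))].

Definition Lfun (R : realType) (m : nat) (u : 'rV[R]_m) (d : nat) (q : R) : R :=
  ln (succ_min (body u (expR q)) d).

(* For a unit vector u in R^m, 1 <= d <= m and q > 0, the quotient lies in
   [0, 1], because the body contains the ball of radius e^-q and is contained
   in the unit ball; hence the limsup is finite and fine only changes its
   type. *)
Definition phibar (R : realType) (m : nat) (d : nat) (u : 'rV[R]_m) : R :=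
  fine (limf_esup (fun q : R => (Lfun u d q / q)%:E) +oo).

(* Main.v *)
Require Import Defs.
From mathcomp Require Import all_boot all_order all_algebra.
From mathcomp Require Import all_classical all_reals all_analysis.
From mathcomp Require Import (canonicals, coercions) mpoly.
From mathcomp Require Import perm zify ring lra.

Set Implicit Arguments.
Unset Strict Implicit.
Unset Printing Implicit Defensive.

Import Order.TTheory GRing.Theory Num.Theory.
Import numFieldNormedType.Exports.
Local Open Scope classical_set_scope.
Local Open Scope ring_scope.

(* Fix n + 1 consecutive lattice points x_k, ..., x_{k+n} forming a basis of
   Z^(n+1), starting from the standard one, and define
   x_{k+n+1} = x_k - c_k x_{k+1} with large integers c_k. By compactness some
   unit vector u has x_k . u >= 0 for all k, and then
   x_k . u = c_k (x_{k+1} . u) + x_{k+n+1} . u makes these products decrease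
   fast. If c_k is about exp (a_{k+n+1} - a_{k+1}) for a nondecreasing sequence
   a, then log |x_k| <= a_k and log (x_k . u) <= - S_k up to O(k), where
   S_k = a_{k+1} + ... + a_{k+n}. For S_k + a_k <= q <= S_k + a_{k+n+1} the
   numbers q - S_k, a_{k+1}, ..., a_{k+n} sum to q, so a determinant estimate
   shows that they are, up to order and O(k), the values L_{u,d}(q). Hence
   the d-th exponent is limsup a_{k+d} / (S_k + a_{k+d}).
   Taking a_{Mn+r} = rho^M b_r with b_0 = 1 <= b_1 <= ... <= b_{n-1} close to 1,
   the maxima are all reached where n divides k + d, and the exponents become
   explicit functions of b_1, ..., b_{n-1}, rho that can be inverted. Their
   values therefore contain an open subset of R^n, on which no nonzero
   polynomial vanishes. *)

(** * Lattice points and successive minima *)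

Lemma dotr0l (R : realType) (m : nat) (y : 'rV[R]_m) : dotr 0 y = 0.
Proof. by rewrite /dotr big1 // => i _; rewrite mxE mul0r. Qed.

Lemma dotrDl (R : realType) (m : nat) (x y z : 'rV[R]_m) :
  dotr (x + y) z = dotr x z + dotr y z.
Proof. by rewrite -big_split; apply: eq_bigr => i _; rewrite mxE mulrDl. Qed.

Lemma dotrZl (R : realType) (m : nat) (l : R) (x y : 'rV[R]_m) :
  dotr (l *: x) y = l * dotr x y.
Proof. by rewrite mulr_sumr; apply: eq_bigr => i _; rewrite mxE mulrA. Qed.

Lemma dotrC (R : realType) (m : nat) (x y : 'rV[R]_m) : dotr x y = dotr y x.
Proof. by apply: eq_bigr => i _; rewrite mulrC. Qed.

Lemma dotr_mulmx (R : realType) (m : nat) (x y : 'rV[R]_m) :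
  dotr x y = (x *m y^T) 0 0.
Proof. by rewrite mxE; apply: eq_bigr => i _; rewrite mxE. Qed.

Lemma dotr_ge0 (R : realType) (m : nat) (x : 'rV[R]_m) : 0 <= dotr x x.
Proof. by apply: sumr_ge0 => i _; rewrite -expr2 sqr_ge0. Qed.

Lemma norm2Z (R : realType) (m : nat) (l : R) (x : 'rV[R]_m) :
  0 <= l -> norm2 (l *: x) = l * norm2 x.
Proof.
move=> l0; rewrite /norm2 dotrZl dotrC dotrZl mulrA -expr2 sqrtrM ?sqr_ge0 //.
by rewrite sqrtr_sqr ger0_norm.
Qed.

Lemma coord_le_norm2 (R : realType) (m : nat) (x : 'rV[R]_m) (i : 'I_m) :
  `|x 0 i| <= norm2 x.
Proof.
rewrite -sqrtr_sqr ler_wsqrtr // /dotr (bigD1 i) //= -expr2 lerDl.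
by apply: sumr_ge0 => j _; rewrite -expr2 sqr_ge0.
Qed.

Lemma norm2_eq0 (R : realType) (m : nat) (x : 'rV[R]_m) :
  norm2 x = 0 -> x = 0.
Proof.
move=> x0; apply/rowP => i; rewrite mxE; apply/eqP.
by rewrite -normr_le0 -x0 coord_le_norm2.
Qed.

Lemma norm2_le (R : realType) (m : nat) (x : 'rV[R]_m) (M : R) :
  (forall i, `|x 0 i| <= M) -> norm2 x <= m%:R * M.
Proof.
case: m x => [|m] x xM.
  by rewrite /norm2 /dotr big_ord0 sqrtr0 mul0r.
have M0 : 0 <= M by apply: le_trans (xM ord0).
rewrite -(ger0_norm (mulr_ge0 (ler0n _ m.+1) M0)) -sqrtr_sqr ler_wsqrtr //.
apply: (@le_trans _ _ (\sum_(i < m.+1) M ^+ 2)).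
  apply: ler_sum => i _; rewrite -expr2 -real_normK ?num_real //.
  by rewrite lerXn2r ?nnegrE.
rewrite sumr_const card_ord exprMn -[leLHS]mulr_natl ler_wpM2r ?sqr_ge0 //.
by rewrite -natrX ler_nat; lia.
Qed.

Lemma scale_bodyP (R : realType) (m : nat) (u z : 'rV[R]_m) (Q l : R) :
  0 < l ->
  [set l *: x | x in body u Q] z <-> norm2 z <= l /\ `|dotr z u| <= l * Q^-1.
Proof.
move=> l0; have l0' := ltW l0; split=> [[x [x1 xQ] <-]|[z1 zQ]].
  rewrite (norm2Z _ l0') dotrZl normrM (gtr0_norm l0).
  by rewrite ler_piMr // ler_pM2l.
exists (l^-1 *: z) => /=; last by rewrite scalerA divff ?gt_eqF // scale1r.
rewrite /body /= norm2Z ?invr_ge0 // mulrC ler_pdivrMr // mul1r; split=> //.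
rewrite dotrZl normrM gtr0_norm ?invr_gt0 // mulrC ler_pdivrMr //.
by rewrite [leRHS]mulrC.
Qed.

(* Replacing the first column of [V] by [V u] multiplies the determinant by
   [u 0 0], and makes one factor of each Leibniz term as small as [k]. *)
Lemma det_bound (R : realType) (m : nat) (V : 'M[R]_m.+1) (u : 'rV[R]_m.+1)
    (w : 'I_m.+1 -> R) (k : R) :
  (forall i c, `|V i c| <= w i) ->
  (forall i, `|dotr (row i V) u| <= k * w i) ->
  `|\det V| * `|u 0 0| <= (m.+1)`!%:R * (k * \prod_i w i).
Proof.
move=> Vw Vu.
pose U : 'M[R]_m.+1 := \matrix_(i, j) if j == 0 then u 0 i else (i == j)%:R.
have detU : \det U = u 0 0.
  rewrite det_trig; last first.
    apply/is_trig_mxP => i j ij; rewrite mxE; case: eqP => [j0|_].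
      by move: ij; rewrite j0 ltn0.
    by rewrite -val_eqE /= (ltn_eqF ij).
  by rewrite (bigD1 0) //= !mxE eqxx big1 ?mulr1 // => i /negPf i0;
    rewrite !mxE i0 eqxx.
have VU i j : `|(V *m U) i j| <= w i * (if j == 0 then k else 1).
  rewrite mxE; case: (eqVneq j 0) => [->|j0].
    rewrite mulrC; apply: le_trans (Vu i); rewrite /dotr.
    by rewrite le_eqVlt; apply/orP; left; apply/eqP; congr `|_|;
      apply: eq_bigr => l _; rewrite !mxE eqxx.
  rewrite (bigD1 j) //= big1 ?addr0 => [|l lj]; last first.
    by rewrite mxE (negPf j0) (negPf lj) mulr0.
  by rewrite !mxE (negPf j0) eqxx !mulr1.
rewrite -detU -normrM -det_mulmx.
apply: le_trans (ler_norm_sum _ _ _) _.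
rewrite -(card_Sn m.+1) mulr_natl -sumr_const.
apply: ler_sum => s _; rewrite normrM normrX normrN1 expr1n mul1r normr_prod.
apply: (@le_trans _ _ (\prod_i (w i * (if s i == 0 then k else 1)))).
  by apply: ler_prod => i _; rewrite normr_ge0 VU.
rewrite big_split /= mulrC.
rewrite -(reindex_inj (@perm_inj _ s) (P := xpredT)
  (F := fun i => if i == 0 then k else 1)) /=.
by rewrite (bigD1 0) //= big1 ?mulr1 // => i /negPf ->.
Qed.

Lemma row_free_coord (F : fieldType) (d m : nat) (M : 'M[F]_(d.+1, m))
    (f : 'I_d -> 'I_m) :
  row_free M -> exists r j, j \notin codom f /\ M r j != 0.
Proof.
move=> Mfree; apply: contrapT => H.
have M0 r j : j \notin codom f -> M r j = 0.
  move=> jf; apply/eqP; apply: contrapT => /negP Mrj.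
  by apply: H; exists r, j.
pose g : 'I_m -> option 'I_d := fun j => [pick s | f s == j].
have MD : M = colsub f M *m \matrix_(s, j) (g j == Some s)%:R.
  apply/matrixP => r j; rewrite mxE.
  case: (boolP (j \in codom f)) => [/codomP[s js]|jf]; last first.
    rewrite M0 // big1 // => s _; rewrite !mxE /g.
    case: pickP => [t /eqP ft|_]; last by rewrite mulr0.
    by move: jf; rewrite -ft codom_f.
  have [t gj ft] : exists2 t, g j = Some t & f t = j.
    rewrite /g; case: pickP => [t /eqP <-|/(_ s)]; first by exists t.
    by rewrite js eqxx.
  rewrite (bigD1 t) //= big1 => [|l lt]; rewrite !mxE gj.
    by rewrite eqxx mulr1 addr0 ft.
  by case: eqP => [[tl]|_]; [move: lt; rewrite tl eqxx | rewrite mulr0].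
move: Mfree; rewrite /row_free MD => /eqP Mr.
by have := mulmx_max_rank (colsub f M)
  (\matrix_(s, j) (g j == Some s)%:R); rewrite Mr ltnn.
Qed.

Lemma succ_min_lower (R : realType) (m d : nat) (u : 'rV[R]_m.+1) (Q l tau : R)
    (X : 'M[int]_m.+1) (w : 'I_m.+1 -> R) (f : 'I_d -> 'I_m.+1)
    (A : 'M[int]_(d.+1, m.+1)) :
  0 < Q -> 0 < l -> \det X != 0 ->
  (forall i c, `|(X i c)%:~R| <= w i) ->
  (forall i, `|dotr (row i (map_mx intr X)) u| <= Q^-1 * w i) ->
  (forall j, j \notin codom f -> tau <= w j) ->
  row_free (map_mx intr A : 'M[R]_(d.+1, m.+1)) ->
  (forall i, [set l *: x | x in body u Q] (row i (map_mx intr A))) ->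
  tau * (Q * `|u 0 0|) <= (m.+1)`!%:R * (l * \prod_i w i).
Proof.
move=> Q0 l0 detX Xw Xu wf Afree Al.
pose XR : 'M[R]_m.+1 := map_mx intr X.
have XRu : XR \in unitmx.
  by rewrite unitmxE det_map_mx unitfE intr_eq0.
pose AR : 'M[R]_(d.+1, m.+1) := map_mx intr A.
have Mfree : row_free (AR *m invmx XR).
  by rewrite /row_free mxrankMfree // row_free_unit unitmx_inv.
have [r [j [jf Mrj]]] := row_free_coord f Mfree.
pose Y : 'M[int]_m.+1 := \matrix_(i, c) if i == j then A r c else X i c.
have w0 i : 0 <= w i by apply: le_trans (Xw i 0).
have detY : \det (map_mx intr Y : 'M[R]_m.+1) = (AR *m invmx XR) r j * \det XR.
  rewrite /invmx XRu -scalemxAr mxE mulrAC mulVf ?mul1r; last first.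
    by rewrite -unitfE -unitmxE.
  rewrite (expand_det_row _ j) mxE; apply: eq_bigr => c _.
  rewrite !mxE eqxx; congr (_ * _).
  rewrite /cofactor; congr (_ * \det _); apply/matrixP => a b.
  by rewrite !mxE eq_sym (negPf (neq_lift _ _)).
have Y1 : 1 <= `|\det (map_mx intr Y : 'M[R]_m.+1)|.
  have : \det (map_mx intr Y : 'M[R]_m.+1) != 0.
    by rewrite detY mulf_neq0 // -unitfE -unitmxE.
  by rewrite det_map_mx intr_eq0 -intr_norm ler1z => ?; lia.
have /(_ r)/(scale_bodyP _ _ _ l0)[Al1 Al2] := Al.
pose w' i := if i == j then l else w i.
have B : `|\det (map_mx intr Y : 'M[R]_m.+1)| * `|u 0 0| <=
    (m.+1)`!%:R * (Q^-1 * \prod_i w' i).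
  apply: det_bound => [i c|i].
    rewrite /w' !mxE; case: eqP => // _; apply: le_trans Al1.
    by have := coord_le_norm2 (row r AR) c; rewrite !mxE.
  rewrite /w'; case: (eqVneq i j) => [ij|ij].
    rewrite (_ : row i _ = row r AR) 1?mulrC //.
    by apply/rowP => c; rewrite !mxE ij eqxx.
  rewrite (_ : row i _ = row i XR) //.
  by apply/rowP => c; rewrite !mxE (negPf ij).
apply: (@le_trans _ _ (w j * (Q * `|u 0 0|))).
  by apply: ler_wpM2r; [rewrite mulr_ge0 // ltW | exact: wf].
rewrite [leRHS](_ : _ =
    w j * (Q * ((m.+1)`!%:R * (Q^-1 * \prod_i w' i)))); last first.
  rewrite (bigD1 j) //= [in RHS](bigD1 j) //= /w' eqxx.
  under [in RHS]eq_bigr => i ij do rewrite (negPf ij).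
  by field; rewrite gt_eqF.
apply: ler_wpM2l => //; apply: ler_wpM2l; first exact: ltW.
by apply: le_trans B; rewrite ler_peMl.
Qed.

Lemma row_free_rowsub (F : fieldType) (d m : nat) (X : 'M[F]_m)
    (g : 'I_d -> 'I_m) :
  injective g -> X \in unitmx -> row_free (rowsub g X).
Proof.
move=> ginj Xu; rewrite rowsubE /row_free mxrankMfree ?row_free_unit //.
apply/row_freeP; exists (rowsub g 1%:M)^T; apply/matrixP => i j.
rewrite mxE (bigD1 (g i)) //= big1 => [|l lg].
  by rewrite !mxE eqxx mul1r addr0 (inj_eq ginj) eq_sym.
by rewrite !mxE eq_sym (negPf lg) mul0r.
Qed.

Lemma row_free_row_neq0 (F : fieldType) (d m : nat) (A : 'M[F]_(d, m))
    (i : 'I_d) : row_free A -> row i A != 0.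
Proof.
move=> Afree; apply/negP => /eqP; rewrite rowE => Ai.
have /rowP/(_ i) : delta_mx 0 i = 0 :> 'rV[F]_d.
  by apply: (row_free_inj Afree); rewrite Ai mul0mx.
by rewrite !mxE !eqxx => /eqP; rewrite oner_eq0.
Qed.

Lemma scale_body_ge1 (R : realType) (m d : nat) (u : 'rV[R]_m) (Q l : R)
    (A : 'M[int]_(d.+1, m)) :
  0 < l -> row_free (map_mx intr A : 'M[R]_(d.+1, m)) ->
  (forall i, [set l *: x | x in body u Q] (row i (map_mx intr A))) -> 1 <= l.
Proof.
move=> l0 Afree /(_ ord0)/(scale_bodyP _ _ _ l0)[Al _].
have /rV0Pn[c] := row_free_row_neq0 ord0 Afree; rewrite !mxE intr_eq0 => Ac.
apply: le_trans Al; apply: le_trans (coord_le_norm2 _ c).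
by rewrite !mxE -intr_norm ler1z; lia.
Qed.

Lemma Lfun_upper (R : realType) (m d : nat) (u : 'rV[R]_m) (q tau : R)
    (X : 'M[int]_m) (t : 'I_m -> R) (g : 'I_d.+1 -> 'I_m) :
  \det X != 0 ->
  (forall i, norm2 (row i (map_mx intr X)) <= expR (t i)) ->
  (forall i, `|dotr (row i (map_mx intr X)) u| <= expR (t i - q)) ->
  injective g -> (forall s, t (g s) <= tau) ->
  Defs.Lfun u d.+1 q <= tau.
Proof.
move=> detX Xn Xu ginj gt.
rewrite /Defs.Lfun -[leRHS]expRK.
have Etau : [set l | 0 < l /\ exists A : 'M[int]_(d.+1, m),
    row_free (map_mx intr A : 'M[R]_(d.+1, m)) /\
    forall i, [set l *: x | x in body u (expR q)] (row i (map_mx intr A))]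
    (expR tau).
  split; first exact: expR_gt0.
  exists (rowsub g X); split.
    rewrite map_mxsub; apply: row_free_rowsub => //.
    by rewrite unitmxE det_map_mx unitfE intr_eq0.
  move=> i; apply/scale_bodyP; first exact: expR_gt0.
  rewrite (_ : row i _ = row (g i) (map_mx intr X)); last first.
    by apply/rowP => c; rewrite !mxE.
  split; first by apply: le_trans (Xn _) _; rewrite ler_expR.
  by apply: le_trans (Xu _) _; rewrite -expRN -expRD ler_expR lerB.
rewrite ler_ln ?posrE ?expR_gt0 //.
  by apply: ge_inf => //; exists 0 => l [/ltW].
apply: lt_le_trans ltr01 _; apply: lb_le_inf; first by exists (expR tau).
by move=> l [l0 [A [Afree Al]]]; apply: scale_body_ge1 Al.
Qed.

Lemma Lfun_lower (R : realType) (m d : nat) (u : 'rV[R]_m.+1) (q tau : R)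
    (X : 'M[int]_m.+1) (t : 'I_m.+1 -> R) (f : 'I_d -> 'I_m.+1) :
  u 0 0 != 0 -> (d <= m)%N -> \det X != 0 ->
  (forall i, norm2 (row i (map_mx intr X)) <= expR (t i)) ->
  (forall i, `|dotr (row i (map_mx intr X)) u| <= expR (t i - q)) ->
  (forall j, j \notin codom f -> tau <= t j) ->
  tau - (\sum_i t i - q) - ln ((m.+1)`!%:R / `|u 0 0|) <= Defs.Lfun u d.+1 q.
Proof.
move=> u0 dm detX Xn Xu ft.
have u0' : 0 < `|u 0 0| by rewrite normr_gt0.
have f0 : 0 < (m.+1)`!%:R :> R by rewrite ltr0n fact_gt0.
pose sigma := tau - (\sum_i t i - q) - ln ((m.+1)`!%:R / `|u 0 0|).
rewrite -/sigma /Defs.Lfun -[leLHS]expRK.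
have lb l : 0 < l -> (exists A : 'M[int]_(d.+1, m.+1),
    row_free (map_mx intr A : 'M[R]_(d.+1, m.+1)) /\
    forall i, [set l *: x | x in body u (expR q)] (row i (map_mx intr A))) ->
    expR sigma <= l.
  move=> l0 [A [Afree Al]].
  have := @succ_min_lower R m d u (expR q) l (expR tau) X (fun i => expR (t i))
    f A (expR_gt0 _) l0 detX.
  have Xc i c : `|(X i c)%:~R| <= expR (t i).
    apply: le_trans (Xn i).
    by have := coord_le_norm2 (row i (map_mx intr X : 'M[R]_m.+1)) c;
      rewrite !mxE.
  have Xd i : `|dotr (row i (map_mx intr X)) u| <= (expR q)^-1 * expR (t i).
    by rewrite -expRN -expRD addrC.
  have tf j : j \notin codom f -> expR tau <= expR (t j).
    by rewrite ler_expR; exact: ft.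
  move=> /(_ Xc Xd tf Afree Al) H.
  have P0 := expR_gt0 (\sum_i t i); have q0 := expR_gt0 q.
  rewrite /sigma expRB lnK ?posrE ?divr_gt0 // expRB expRB.
  rewrite [leLHS](_ : _ = expR tau * (expR q * `|u 0 0|) /
    ((m.+1)`!%:R * expR (\sum_i t i))); last by field; rewrite !gt_eqF.
  rewrite ler_pdivrMr ?mulr_gt0 // expR_sum [leRHS]mulrCA; exact: H.
have ge1 : 0 < expR sigma by exact: expR_gt0.
suff H : expR sigma <= succ_min (body u (expR q)) d.+1.
  by rewrite ler_ln ?posrE //; apply: lt_le_trans H.
apply: lb_le_inf => [|l [l0 lA]]; last exact: lb.
exists (expR (\sum_i `|t i|)); split; first exact: expR_gt0.
have dm' : (d.+1 <= m.+1)%N by [].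
exists (rowsub (widen_ord dm') X); split.
  rewrite map_mxsub; apply: row_free_rowsub.
    by move=> i j /(congr1 val) /= /val_inj.
  by rewrite unitmxE det_map_mx unitfE intr_eq0.
move=> i; apply/scale_bodyP; first exact: expR_gt0.
rewrite (_ : row i _ = row (widen_ord dm' i) (map_mx intr X)); last first.
  by apply/rowP => c; rewrite !mxE.
have tS j : t j <= \sum_i `|t i|.
  rewrite (bigD1 j) //=; apply: ler_wpDr; last exact: ler_norm.
  by apply: sumr_ge0.
split; first by apply: le_trans (Xn _) _; rewrite ler_expR.
by apply: le_trans (Xu _) _; rewrite -expRN -expRD ler_expR lerB.
Qed.

(** * A multidimensional continued fraction *)

(* [window n c k i] is x_{k+i} for [i <= n] and is meaningless for larger [i]. *)
Fixpoint window (n : nat) (c : nat -> nat) (k : nat) : nat -> 'rV[int]_n.+1 :=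
  if k is k'.+1 then
    fun i => if (i < n)%N then window n c k' i.+1
             else window n c k' 0 - (c k')%:Z *: window n c k' 1
  else fun i => delta_mx 0 (inord i).

Definition lpoint (n : nat) (c : nat -> nat) (k : nat) : 'rV[int]_n.+1 :=
  window n c k 0.

Lemma windowE (n : nat) (c : nat -> nat) (k i : nat) :
  (i <= n)%N -> window n c k i = lpoint n c (k + i).
Proof.
elim: i k => [|i IHi] k i_n; first by rewrite addn0.
by rewrite addnS -addSn -IHi ?(ltnW i_n) //= i_n.
Qed.

Lemma point_init (n : nat) (c : nat -> nat) (i : nat) :
  (i <= n)%N -> lpoint n c i = delta_mx 0 (inord i).
Proof. by move=> i_n; rewrite -[i]add0n -windowE. Qed.

Lemma point_rec (n : nat) (c : nat -> nat) (k : nat) : (0 < n)%N ->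
  lpoint n c (k + n.+1) = lpoint n c k - (c k)%:Z *: lpoint n c k.+1.
Proof.
move=> n0; rewrite addnS -addSn -windowE //= ltnn windowE // addn0.
by rewrite windowE // addn1.
Qed.

Definition rpoint (R : realType) (n : nat) (c : nat -> nat) (k : nat) :
  'rV[R]_n.+1 := map_mx intr (lpoint n c k).

Lemma dotr_rpoint0 (R : realType) (n : nat) (c : nat -> nat)
    (u : 'rV[R]_n.+1) : dotr (rpoint R n c 0) u = u 0 0.
Proof.
have inord0 : inord 0 = 0 :> 'I_n.+1 by apply/val_inj; rewrite /= inordK.
rewrite /dotr (bigD1 0) //= big1 => [|i i0];
  rewrite !mxE inord0.
  by rewrite !eqxx mul1r addr0.
by rewrite (negPf i0) andbF mul0r.
Qed.

Lemma dotr_rpoint_rec (R : realType) (n : nat) (c : nat -> nat) (k : nat)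
    (u : 'rV[R]_n.+1) : (0 < n)%N ->
  dotr (rpoint R n c k) u =
  (c k)%:R * dotr (rpoint R n c k.+1) u + dotr (rpoint R n c (k + n.+1)) u.
Proof.
move=> n0; rewrite /rpoint point_rec // map_mxB map_mxZ -scaleN1r.
by rewrite dotrDl !dotrZl mulN1r addrC subrK.
Qed.

Definition basis (n : nat) (c : nat -> nat) (k : nat) : 'M[int]_n.+1 :=
  \matrix_(i < n.+1) lpoint n c (k + i).

Lemma row_basis (R : realType) (n : nat) (c : nat -> nat) (k : nat)
    (i : 'I_n.+1) :
  row i (map_mx intr (basis n c k)) = rpoint R n c (k + i).
Proof. by apply/rowP => j; rewrite !mxE. Qed.

Lemma window_orthogonal (R : realType) (n : nat) (c : nat -> nat) (k : nat)
    (u : 'rV[R]_n.+1) : (0 < n)%N ->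
  (forall i, (i <= n)%N -> dotr (rpoint R n c (k + i)) u = 0) -> u = 0.
Proof.
move=> n0; elim: k => [|k IHk] H.
  apply/rowP => i; rewrite mxE -(H i (leq_ord i)).
  rewrite add0n /rpoint point_init ?leq_ord // inord_val.
  rewrite /dotr (bigD1 i) //= big1 => [|j ji]; rewrite !mxE.
    by rewrite !eqxx mul1r addr0.
  by rewrite (negPf ji) andbF mul0r.
apply: IHk => -[_|i i_n]; last by rewrite addnS -addSn (H _ (ltnW i_n)).
rewrite addn0 dotr_rpoint_rec //; have := H 0%N; rewrite addn0 => -> //.
by rewrite addnS -addSn H // mulr0 addr0.
Qed.

Lemma basis_unit (R : realType) (n : nat) (c : nat -> nat) (k : nat) :
  (0 < n)%N -> (map_mx intr (basis n c k) : 'M[R]_n.+1) \in unitmx.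
Proof.
move=> n0; rewrite -unitmx_tr -row_free_unit; apply: inj_row_free => v vX.
apply: (@window_orthogonal R n c k v n0) => i i_n.
rewrite -[i]/(val (Ordinal (i_n : (i < n.+1)%N))) -row_basis dotrC.
rewrite dotr_mulmx tr_row colE mulmxA vX mul0mx.
by rewrite mxE.
Qed.

Lemma det_basis (R : realType) (n : nat) (c : nat -> nat) (k : nat) :
  (0 < n)%N -> \det (basis n c k) != 0.
Proof.
move=> /(@basis_unit R n c k).
by rewrite unitmxE det_map_mx unitfE intr_eq0.
Qed.

Lemma nonneg_before (R : realType) (n : nat) (c : nat -> nat) (k : nat)
    (u : 'rV[R]_n.+1) : (0 < n)%N ->
  (forall i, (i <= n)%N -> 0 <= dotr (rpoint R n c (k + i)) u) ->
  forall j, (j <= k + n)%N -> 0 <= dotr (rpoint R n c j) u.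
Proof.
move=> n0; elim: k => [|k IHk] H j jk.
  by rewrite -[j]add0n; exact: H.
case: (leqP j (k + n)) => jkn; last first.
  rewrite (_ : j = (k.+1 + n)%N); last by lia.
  exact: H.
apply: IHk jkn => -[_|i i_n]; last by rewrite addnS -addSn (H _ (ltnW i_n)).
rewrite addn0 dotr_rpoint_rec //.
have := H 0%N; rewrite addn0 => H0.
by rewrite addr_ge0 ?mulr_ge0 ?H0 // addnS -addSn H.
Qed.

(* The dual basis vector of x_k works, by [nonneg_before]. *)
Lemma nonneg_initial (R : realType) (n : nat) (c : nat -> nat) (k : nat) :
  (0 < n)%N -> exists u : 'rV[R]_n.+1, dotr u u = 1 /\
    forall j, (j <= k)%N -> 0 <= dotr (rpoint R n c j) u.
Proof.
move=> n0; have Xu := @basis_unit R n c k n0.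
pose X : 'M[R]_n.+1 := map_mx intr (basis n c k).
pose v : 'rV[R]_n.+1 := delta_mx 0 0 *m (invmx X)^T.
have Xv (i : 'I_n.+1) : dotr (rpoint R n c (k + i)) v = (i == 0)%:R.
  rewrite -row_basis dotr_mulmx trmx_mul trmxK mulmxA -row_mul mulmxV //.
  by rewrite mxE (bigD1 i) //= big1 => [|j ji]; rewrite !mxE ?eqxx ?mul1r
    ?addr0 ?eqxx ?andbT // eq_sym (negPf ji) mul0r.
have v0 : 0 < norm2 v.
  rewrite lt_def sqrtr_ge0 andbT; apply/eqP => /norm2_eq0 v0.
  have := Xv 0; rewrite v0 dotrC dotr0l => /eqP.
  by rewrite eqxx eq_sym oner_eq0.
exists ((norm2 v)^-1 *: v); split.
  rewrite dotrZl dotrC dotrZl mulrA -expr2 exprVn sqr_sqrtr ?dotr_ge0 //.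
  by rewrite mulVf // gt_eqF // -sqrtr_gt0.
move=> j jk; rewrite dotrC dotrZl mulr_ge0 ?invr_ge0 ?(ltW v0) // dotrC.
apply: (@nonneg_before R n c k v n0); last by rewrite (leq_trans jk) ?leq_addr.
by move=> i i_n; rewrite -[i]/(val (Ordinal (i_n : (i < n.+1)%N))) Xv.
Qed.

Lemma dotr_continuous (R : realType) (m : nat) (x : 'rV[R]_m) :
  continuous (dotr x).
Proof.
apply: continuous_big => [|i _ y]; first exact: add_continuous.
have H := @coord_continuous R 1 m 0 i y.
by apply: cvgMl_tmp; [exact: (nbhs_filter y) | exact: H].
Qed.

Lemma dotr_self_continuous (R : realType) (m : nat) :
  continuous (fun x : 'rV[R]_m => dotr x x).
Proof.
apply: continuous_big => [|i _ y]; first exact: add_continuous.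
have H := @coord_continuous R 1 m 0 i y.
by apply: cvgM; [exact: (nbhs_filter y) | exact: H | exact: H].
Qed.

Lemma nonneg_direction (R : realType) (n : nat) (c : nat -> nat) :
  (0 < n)%N -> exists u : 'rV[R]_n.+1, norm2 u = 1 /\
    forall j, 0 <= dotr (rpoint R n c j) u.
Proof.
move=> n0.
pose S := [set u : 'rV[R]_n.+1 | dotr u u = 1].
pose K k := S `&` [set u | forall j, (j <= k)%N ->
  0 <= dotr (rpoint R n c j) u].
have Scompact : compact S.
  apply: bounded_closed_compact.
    exists 1; split; first exact: num_real.
    move=> M M1 u Su /=; rewrite /Num.norm /= mx_normrE.
    apply/bigmax_leP; split=> [|[i j] _ /=]; first exact: ltW (lt_trans ltr01 M1).
    rewrite ord1; apply: le_trans (ltW M1).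
    apply: le_trans (coord_le_norm2 u j) _.
    by rewrite /norm2 Su sqrtr1.
  apply: (closed_comp _ (@closed_eq R 1)) => u _.
  exact: dotr_self_continuous.
have := Scompact (filter_from setT K).
case.
- apply: filter_from_proper.
  apply: filter_from_filter; first by exists 0%N.
    move=> i j _ _; exists (maxn i j) => // u [Su Ku]; split; split=> // l li;
      by apply: Ku; rewrite (leq_trans li) ?leq_maxl ?leq_maxr.
  by move=> k _; have [u [u1 uk]] := @nonneg_initial R n c k n0; exists u.
- by exists 0%N => // u [].
move=> u [Su]; rewrite clusterE => uK; exists u; split.
  by rewrite /norm2 Su sqrtr1.
move=> j; have : closure (dotr (rpoint R n c j) @^-1` [set y | 0 <= y]) u.
  apply: uK; exists j => // v [_ /(_ j)]; exact.
apply: (closed_comp _ (@closed_ge R 0)) => v _; exact: dotr_continuous.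
Qed.

Lemma positive_direction (R : realType) (n : nat) (c : nat -> nat) :
  (0 < n)%N -> (forall k, (0 < c k)%N) ->
  exists u : 'rV[R]_n.+1, norm2 u = 1 /\
    forall j, 0 < dotr (rpoint R n c j) u.
Proof.
move=> n0 c0; have [u [u1 u0]] := @nonneg_direction R n c n0.
exists u; split=> // j; rewrite lt_def u0 andbT; apply/eqP => uj.
have uji i : dotr (rpoint R n c (j + i)) u = 0.
  elim: i => [|i]; first by rewrite addn0.
  rewrite dotr_rpoint_rec // => /eqP; rewrite paddr_eq0 ?mulr_ge0 ?u0 //.
  by rewrite mulf_eq0 pnatr_eq0 eqn0Ngt c0 /= (addnS j i) => /andP[/eqP].
have /esym/eqP := u1; rewrite (@window_orthogonal R n c j u n0) //.
by rewrite /norm2 dotr0l sqrtr0 oner_eq0.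
Qed.

(** * Directions with prescribed growth *)

(* This is S_k. *)
Definition wsum (R : realType) (n : nat) (a : nat -> R) (k : nat) : R :=
  \sum_(i < n) a (k + i.+1)%N.

Lemma wsumS (R : realType) (n : nat) (a : nat -> R) (k : nat) :
  wsum n a k.+1 = wsum n a k + (a (k + n.+1)%N - a k.+1).
Proof.
case: n => [|n]; first by rewrite /wsum !big_ord0 addn1 subrr addr0.
rewrite /wsum big_ord_recr [in RHS]big_ord_recl /= addSnnS addn1.
under [in RHS]eq_bigr do rewrite /bump /= add1n -addSnnS.
by ring.
Qed.

Definition growth_quotient (R : realType) (n : nat) (a : nat -> R)
    (k : nat) : nat :=
  Num.truncn (expR (a (k + n.+1)%N - a k.+1)).

Section Growth.
Context (R : realType) (n : nat) (a : nat -> R).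
Hypothesis n0 : (0 < n)%N.
Hypothesis a0 : 0 <= a 0.
Hypothesis aS : forall k, a k <= a k.+1.

Lemma seq_mono i j : (i <= j)%N -> a i <= a j.
Proof. exact: (homo_leq (@lexx _ _) (@le_trans _ _)). Qed.

Lemma quotient_bounds k :
  [/\ (0 < growth_quotient n a k)%N,
      (growth_quotient n a k)%:R <= expR (a (k + n.+1)%N - a k.+1) &
      expR (a (k + n.+1)%N - a k.+1) <= 2 * (growth_quotient n a k)%:R].
Proof.
have q0 : (0 < growth_quotient n a k)%N.
  rewrite truncn_gt0 -[leLHS]expR0 ler_expR subr_ge0; apply: seq_mono.
  by rewrite addnS ltnS leq_addr.
split=> //; first by rewrite truncn_le ltW ?expR_gt0.
apply: le_trans (ltW (truncnS_gt _)) _; rewrite -/(growth_quotient n a k).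
by rewrite -natrM ler_nat; lia.
Qed.

Lemma two_le_expR1 : 2 <= expR 1 :> R.
Proof. by apply: le_trans (expR_ge1Dx 1); rewrite -natr1. Qed.

Lemma point_bound k (i : 'I_n.+1) :
  `|rpoint R n (growth_quotient n a) k 0 i| <= expR (a k + k%:R).
Proof.
elim/ltn_ind: k => k IHk; case: (leqP k n) => [kn|nk].
  apply: (@le_trans _ _ 1).
    by rewrite !mxE point_init // mxE; case: (_ && _); rewrite ?normr1 ?normr0.
  rewrite -[leLHS]expR0 ler_expR addr_ge0 //.
  by apply: le_trans a0 (seq_mono (leq0n k)).
have [j kE] : exists j, k = (j + n.+1)%N by exists (k - n.+1)%N; lia.
have [_ c1 _] := quotient_bounds j.
rewrite {1}kE /rpoint point_rec // !mxE rmorphB rmorphM /=.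
apply: le_trans (ler_normB _ _) _.
have e1 : `|((lpoint n (growth_quotient n a) j) 0 i)%:~R : R| <=
    expR (a j + j%:R).
  by have := IHk j; rewrite /rpoint !mxE; apply; lia.
have e2 : `|(growth_quotient n a j)%:~R *
    ((lpoint n (growth_quotient n a) j.+1) 0 i)%:~R : R| <=
    expR (a k - a j.+1) * expR (a j.+1 + j.+1%:R).
  rewrite normrM ger0_norm //; apply: ler_pM => //; first by rewrite kE.
  by have := IHk j.+1; rewrite /rpoint !mxE; apply; lia.
apply: le_trans (lerD e1 e2) _; rewrite -expRD addrA subrK.
have jk : (j.+2 <= k)%N by lia.
apply: (@le_trans _ _ (2 * expR (a k + j.+1%:R))).
  rewrite mulr_natl mulr2n lerD2r ler_expR lerD ?ler_nat //.
  by apply: seq_mono; lia.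
apply: (@le_trans _ _ (expR 1 * expR (a k + j.+1%:R))).
  by rewrite ler_wpM2r ?two_le_expR1 // ltW ?expR_gt0.
by rewrite -expRD addrC -addrA natr1 ler_expR lerD2l ler_nat.
Qed.

Lemma dot_bound (u : 'rV[R]_n.+1) k : norm2 u = 1 ->
  (forall j, 0 < dotr (rpoint R n (growth_quotient n a) j) u) ->
  dotr (rpoint R n (growth_quotient n a) k) u <=
  expR (wsum n a 0 + k%:R - wsum n a k).
Proof.
move=> u1 upos; elim: k => [|k IHk].
  rewrite addr0 subrr expR0 -u1; apply: le_trans (coord_le_norm2 u 0).
  by rewrite dotr_rpoint0 ler_norm.
have [c0 _ c2] := quotient_bounds k.
have H : expR (a (k + n.+1)%N - a k.+1) *
    dotr (rpoint R n (growth_quotient n a) k.+1) u <=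
    expR 1 * dotr (rpoint R n (growth_quotient n a) k) u.
  apply: (@le_trans _ _ (2 * ((growth_quotient n a k)%:R *
      dotr (rpoint R n (growth_quotient n a) k.+1) u))).
    by rewrite mulrA ler_wpM2r // ltW.
  apply: ler_pM => //; rewrite ?two_le_expR1 //.
    by rewrite mulr_ge0 // ltW.
  by rewrite [leRHS]dotr_rpoint_rec // lerDl ltW.
rewrite -(ler_pM2l (expR_gt0 (a (k + n.+1)%N - a k.+1))).
apply: le_trans H _; apply: (@le_trans _ _ (expR 1 *
  expR (wsum n a 0 + k%:R - wsum n a k))).
  by rewrite ler_pM2l ?expR_gt0.
by rewrite -!expRD ler_expR wsumS -natr1; lra.
Qed.

Lemma add_wsum_mono i j : (i <= j)%N -> a i + wsum n a i <= a j + wsum n a j.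
Proof.
have step k : a k + wsum n a k <= a k.+1 + wsum n a k.+1.
  rewrite wsumS.
  have : a k <= a (k + n.+1)%N by apply: seq_mono; rewrite leq_addr.
  by lra.
exact: (homo_leq (f := fun k => a k + wsum n a k)
  (@lexx _ _) (@le_trans _ _) step).
Qed.

Lemma wsum_ge0 k : 0 <= wsum n a k.
Proof.
by apply: sumr_ge0 => i _; apply: le_trans a0 (seq_mono (leq0n _)).
Qed.

(* The basis x_k, ..., x_{k+n} computes the minima at all the [q] considered
   here: x_k contributes [q - wsum n a k] and x_{k+i} contributes [a (k + i)]. *)
Theorem regular_direction : exists (u : 'rV[R]_n.+1) (C : R), norm2 u = 1 /\
  forall k q d, wsum n a k + a k <= q <= wsum n a k + a (k + n.+1)%N ->
    (d < n)%N ->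
    [/\ Defs.Lfun u d.+1 q <=
          Num.max (q - wsum n a k) (a (k + d)%N) + C * k.+1%:R,
        Defs.Lfun u d.+1 q <= a (k + d.+1)%N + C * k.+1%:R &
        a (k + d.+1)%N <= q - wsum n a k ->
        a (k + d.+1)%N - C * k.+1%:R <= Defs.Lfun u d.+1 q].
Proof.
have c0 k : (0 < growth_quotient n a k)%N by case: (quotient_bounds k).
have [u [u1 upos]] := @positive_direction R n _ n0 c0.
pose K := ln ((n.+1)`!%:R / `|u 0 0|).
pose D := (2 * n).+1%:R + wsum n a 0.
pose C := n.+1%:R * D + `|K|.
exists u, C; split=> // k q d /andP[q1 q2] dn.
have D0 : 0 <= D by rewrite addr_ge0 ?wsum_ge0.
pose B := k%:R + (2 * n)%:R + wsum n a 0.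
have BD : B <= D * k.+1%:R.
  rewrite /B /D -[in leRHS]natr1 -natr1.
  have := wsum_ge0 0; have k0 := ler0n R k; have := ler0n R (2 * n).
  move: (wsum n a 0) (k%:R) ((2 * n)%:R) k0 => s x y x0 y0 s0.
  by nra.
have B0 : 0 <= B by rewrite !addr_ge0 ?wsum_ge0.
pose t (i : 'I_n.+1) := (if i == 0 then q - wsum n a k else a (k + i)%N) + B.
have tsum : \sum_i t i = q + n.+1%:R * B.
  rewrite big_split sumr_const card_ord /= -[B *+ _]mulr_natl; congr (_ + _).
  rewrite big_ord_recl /= /wsum (eq_bigr (fun i : 'I_n => a (k + i.+1)%N)).
    by rewrite subrK.
  by move=> i _; rewrite /bump add1n.
pose X := basis n (growth_quotient n a) k.
have detX : \det X != 0 by exact: det_basis R _ _ _ n0.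
have akt (i : 'I_n.+1) : a (k + i)%N + B <= t i.
  rewrite /t lerD2r; case: eqP => // -> /=; rewrite addn0; lra.
have iN (i : 'I_n.+1) : (i <= n)%N by rewrite -ltnS.
have Xn i : norm2 (row i (map_mx intr X)) <= expR (t i).
  rewrite row_basis; apply: le_trans (norm2_le (point_bound _)) _.
  apply: (@le_trans _ _ (expR n%:R * expR (a (k + i)%N + (k + i)%:R))).
    rewrite ler_wpM2r ?expR_ge0 // -natr1 addrC; exact: expR_ge1Dx.
  rewrite -expRD ler_expR; apply: le_trans (akt i).
  rewrite addrCA lerD2l /B -!natrD ler_wpDr ?wsum_ge0 // ler_nat.
  by have := iN i; lia.
have Xu i : `|dotr (row i (map_mx intr X)) u| <= expR (t i - q).
  rewrite row_basis ger0_norm ?(ltW (upos _)) //.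
  apply: le_trans (dot_bound _ u1 upos) _.
  rewrite ler_expR /t /B; case: (eqVneq i 0) => [->|i0].
    by rewrite /= addn0; have := ler0n R (2 * n); lra.
  have : q <= a (k + i)%N + wsum n a (k + i)%N.
    apply: le_trans q2 _; apply: le_trans (add_wsum_mono (_ : k.+1 <= _)%N).
      by rewrite wsumS; lra.
    by rewrite -addn1 leq_add2l lt0n.
  have : (k + i)%:R <= k%:R + (2 * n)%:R :> R.
    by rewrite -natrD ler_nat; have := iN i; lia.
  by lra.
have BC : B <= C * k.+1%:R.
  apply: le_trans BD _; rewrite ler_wpM2r // /C ler_wpDr //.
  by rewrite ler_peMl // ler1n.
split.
- have dn' : (d.+1 <= n.+1)%N by lia.
  apply: (@Lfun_upper R n.+1 d u q _ X t (widen_ord dn')) => //.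
    by move=> i j /(congr1 val) /= /val_inj.
  move=> s; apply: lerD => //; rewrite le_max; case: eqP => [|_].
    by rewrite lexx.
  by rewrite /= seq_mono ?orbT // leq_add2l -ltnS.
- have dn' : (d.+1 <= n)%N by lia.
  apply: (@Lfun_upper R n.+1 d u q _ X t (fun s => lift 0 (widen_ord dn' s))).
  + exact: detX.
  + exact: Xn.
  + exact: Xu.
  + by move=> i j /lift_inj /(congr1 val) /= /val_inj.
  move=> s; rewrite /t eq_sym (negPf (neq_lift _ _)) lift0.
  by apply: lerD => //; apply: seq_mono; rewrite leq_add2l; exact: (ltn_ord s).
move=> adq.
have u00 : u 0 0 != 0.
  by rewrite -(dotr_rpoint0 (growth_quotient n a)) gt_eqF.
have dn' : (d <= n)%N by lia.
have := @Lfun_lower R n d u q (a (k + d.+1)%N + B) X t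
  (fun s => lift 0 (widen_ord dn' s)) u00 dn' detX Xn Xu.
rewrite tsum -/K => H; apply: le_trans (H _).
  have : n%:R * B <= n%:R * (D * k.+1%:R) by rewrite ler_wpM2l.
  have : K <= `|K| * k.+1%:R.
    by apply: le_trans (ler_norm _) _; rewrite ler_peMr // ler1n.
  have : 0 <= D * k.+1%:R by rewrite mulr_ge0.
  rewrite /C -natr1; lra.
move=> j jd; rewrite /t lerD2r; case: eqP => // j0.
apply: seq_mono; rewrite leq_add2l ltnNge; apply/negP => jd'.
have jpos : (0 < j)%N.
  by rewrite lt0n; apply/eqP => j00; apply: j0; apply/val_inj.
have jd1 : (j.-1 < d)%N by rewrite prednK.
case/negP: jd; apply/codomP; exists (Ordinal jd1); apply/val_inj.
by rewrite /= /bump add1n prednK.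
Qed.

End Growth.

Lemma phibar_eq (R : realType) (m d : nat) (u : 'rV[R]_m) (G : R) :
  (forall e : R, 0 < e ->
    exists M, forall q, M < q -> Defs.Lfun u d q <= (G + e) * q) ->
  (forall e M : R, 0 < e ->
    exists2 q, 0 < q /\ M < q & (G - e) * q <= Defs.Lfun u d q) ->
  phibar d u = G.
Proof.
move=> up lo; rewrite /phibar.
suff -> : limf_esup (fun q : R => (Defs.Lfun u d q / q)%:E) +oo = G%:E by [].
rewrite limf_esupE; apply/le_anti/andP; split.
  apply/lee_addgt0Pr => e /up[M HM].
  apply: (@le_trans _ _ (ereal_sup ((fun q : R => (Defs.Lfun u d q / q)%:E) @`
      [set q | Num.max M 0 < q]))).
    apply: ereal_inf_lbound; exists [set q | Num.max M 0 < q] => //.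
    by exists (Num.max M 0); split; first exact: num_real.
  apply: ge_ereal_sup => _ [q /= qM <-].
  move: qM; rewrite gt_max => /andP[Mq q0].
  by rewrite -EFinD lee_fin ler_pdivrMr //; exact: HM.
apply: le_ereal_inf_tmp => _ [A [M [_ HM]] <-].
apply/lee_addgt0Pr => e e0; have [q [q0 Mq] Hq] := lo e M e0.
apply: (@le_trans _ _ ((Defs.Lfun u d q / q)%:E + e%:E)%E).
  by rewrite -EFinD lee_fin -lerBlDr ler_pdivlMr.
by rewrite leeD2r //; apply: ereal_sup_ubound; exists q => //; exact: HM.
Qed.

(** * The exponents *)

Section Limsup.
Context (R : realType) (n : nat) (a : nat -> R) (D : R).
Hypothesis n0 : (0 < n)%N.
Hypothesis a0 : 0 <= a 0.
Hypothesis aS : forall k, a k <= a k.+1.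
Hypothesis aD : forall k, k.+1%:R ^+ 2 <= D * a k.

Lemma linear_error (C e : R) : 0 < e ->
  exists N, forall k, (N <= k)%N -> C * k.+1%:R <= e * a k.
Proof.
move=> e0.
have D0 : 0 < D.
  have a00 : 0 <= a 0 by [].
  have := aD 0; rewrite expr1n => H; rewrite ltNge; apply/negP => D0.
  by have : D * a 0 <= 0 by [nra]; lra.
exists (Num.bound (D * `|C| / e)) => k kN.
have H : D * `|C| / e <= k.+1%:R.
  apply: ltW; apply: lt_le_trans (archi_boundP _) _.
    by rewrite divr_ge0 ?mulr_ge0 // ltW.
  by rewrite ler_nat ltnW.
rewrite -(ler_pM2l D0); apply: (@le_trans _ _ (D * (`|C| * k.+1%:R))).
  by rewrite ler_pM2l // ler_wpM2r // ler_norm.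
rewrite ler_pdivrMr // in H.
rewrite mulrA [leRHS]mulrCA; apply: (@le_trans _ _ (e * k.+1%:R ^+ 2)).
  by rewrite expr2 mulrA ler_wpM2r // [e * _]mulrC.
by rewrite ler_pM2l.
Qed.

Lemma seq_gt (M : R) : exists N, forall k, (N <= k)%N -> M < a k.
Proof.
have [N HN] := @linear_error (`|M| + 1) 1 ltr01.
exists N => k /HN; rewrite mul1r; apply: lt_le_trans.
apply: (@lt_le_trans _ _ (`|M| + 1)); first by have := ler_norm M; lra.
by rewrite ler_peMr ?addr_ge0 // ler1n.
Qed.

Lemma stage_exists (N : nat) (q : R) :
  wsum n a N + a N <= q -> exists2 k, (N <= k)%N &
    wsum n a k + a k <= q <= wsum n a k + a (k + n.+1)%N.
Proof.
move=> qN; have [K HK] := seq_gt q.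
have ex : exists k, q < wsum n a k + a k.
  by exists K; apply: lt_le_trans (HK K (leqnn K)) _; rewrite lerDr wsum_ge0.
have [k qk kmin] := ex_minnP ex.
have kN : (N < k)%N.
  rewrite ltnNge; apply/negP => kN.
  have := @add_wsum_mono R n a aS k N kN; lra.
exists k.-1; first by lia.
have kE : k = k.-1.+1 by lia.
apply/andP; split.
  by rewrite leNgt; apply/negP => /kmin; lia.
by have := ltW qk; rewrite {1 2}kE wsumS; lra.
Qed.

(* On the k-th stage the d-th minimum over q is largest when q - S_k, moving
   with slope 1, meets a_{k+d}. *)
Theorem phibar_regular : exists u : 'rV[R]_n.+1, norm2 u = 1 /\
  forall (d : nat) (G : R), (d < n)%N -> 0 <= G <= 1 ->
    (forall k, a (k + d.+1)%N <= G * (wsum n a k + a (k + d.+1)%N)) ->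
    (forall N, exists2 k, (N <= k)%N &
      a (k + d.+1)%N = G * (wsum n a k + a (k + d.+1)%N)) ->
    phibar d.+1 u = G.
Proof.
have [u [C [u1 H]]] := @regular_direction R n a n0 a0 aS.
exists u; split=> // d G dn /andP[G0 G1] Gup Glo.
have a_ge0 k : 0 <= a k by apply: le_trans a0 (seq_mono aS (leq0n k)).
have w0 := @wsum_ge0 R n a a0 aS.
apply: phibar_eq => [e e0|e M e0].
  have [N HN] := @linear_error C e e0.
  exists (wsum n a N.+1 + a N.+1) => q /ltW /stage_exists[k Nk qk].
  have [L1 L2 _] := H k q d qk dn; move/andP: qk => [q1 q2].
  have ek : C * k.+1%:R <= e * q.
    apply: le_trans (HN k (ltnW Nk)) _; rewrite ler_pM2l //.
    by have := w0 k; lra.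
  have [T1|T1] := lerP (a (k + d.+1)%N) (q - wsum n a k).
    have : a (k + d.+1)%N <= G * q.
      by apply: le_trans (Gup k) _; rewrite ler_wpM2l //; lra.
    by lra.
  have [T2|T2] := lerP (a (k + d)%N) (q - wsum n a k).
    have : q - wsum n a k <= G * q.
      by have := Gup k; have := w0 k; nra.
    by move: L1; rewrite (max_idPl T2); lra.
  have kE : k = k.-1.+1 by lia.
  have : a (k + d)%N <= G * q.
    have := Gup k.-1; rewrite addnS -addSn -kE => Gk; apply: le_trans Gk _.
    rewrite ler_wpM2l // {2}kE addSn -addnS.
    have : a (k.-1 + d.+1)%N <= a (k.-1 + n.+1)%N.
      by apply: (seq_mono aS); lia.
    by have := wsumS n a k.-1; rewrite -kE; lra.
  by move: L1; rewrite (max_idPr (ltW T2)); lra.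
have [N1 HN1] := @linear_error C e e0.
have [N2 HN2] := seq_gt (Num.max M 0).
have [k] := Glo (maxn N1 N2); rewrite geq_max => /andP[Nk1 Nk2] Gk.
pose q := wsum n a k + a (k + d.+1)%N.
have akd : a k <= a (k + d.+1)%N by apply: (seq_mono aS); lia.
have aq : a k <= q by rewrite /q; have := w0 k; lra.
have := HN2 k Nk2; rewrite gt_max => /andP[Mak ak0].
have qk : wsum n a k + a k <= q <= wsum n a k + a (k + n.+1)%N.
  by rewrite !lerD2l akd /=; apply: (seq_mono aS); lia.
exists q; first by split; apply: lt_le_trans aq.
have [_ _ L3] := H k q d qk dn.
have := L3; rewrite {1}/q addrAC subrr add0r => /(_ (lexx _)).
have := HN1 k Nk1; rewrite -/q in Gk *.
by nra.
Qed.

End Limsup.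

Section Periodic.
Context (R : realType) (p : nat) (b : nat -> R).
Hypothesis b0 : b 0 = 1.
Hypothesis bS : forall i, (i < p)%N -> b i <= b i.+1.
Hypothesis bp : b p <= 1 + (4 * p.+1%:R)^-1.

Definition bsum (r : nat) : R := \sum_(i < r) b i.+1.

Lemma b_mono i j : (i <= j <= p)%N -> b i <= b j.
Proof.
move=> /andP[]; elim: j => [|j IHj].
  by rewrite leqn0 => /eqP ->.
rewrite leq_eqVlt ltnS => /orP[/eqP -> //|ij] jp.
by apply: le_trans (IHj ij (ltnW jp)) (bS _).
Qed.

Lemma b_ge1 i : (i <= p)%N -> 1 <= b i.
Proof. by move=> ip; rewrite -b0 b_mono. Qed.

Lemma b_le i : (i <= p)%N -> b i <= 1 + (4 * p.+1%:R)^-1.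
Proof. by move=> ip; apply: le_trans bp; rewrite b_mono ?ip /=. Qed.

Lemma b_le54 i : (i <= p)%N -> b i <= 5 / 4.
Proof.
move=> ip; apply: le_trans (b_le ip) _.
have : (4 * p.+1%:R)^-1 <= 4^-1 :> R.
  by rewrite lef_pV2 ?posrE ?mulr_gt0 // ler_peMr // ler1n.
by move: ((4 * p.+1%:R)^-1) => x; lra.
Qed.

Lemma bsum_step r s : (r + s <= p)%N -> s%:R <= bsum (r + s) - bsum r.
Proof.
elim: s => [|s IHs] rs; first by rewrite addn0 subrr.
rewrite addnS /bsum big_ord_recr /= -/(bsum _) -/(bsum _) -natr1.
have rs' : (r + s <= p)%N by lia.
by have := IHs rs'; have := @b_ge1 (r + s).+1; rewrite -addnS => /(_ rs); lra.
Qed.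

Lemma bsum_ge0 r : (r <= p)%N -> 0 <= bsum r.
Proof.
move=> rp; have := @bsum_step 0 r rp.
rewrite add0n {2}/bsum big_ord0 subr0; apply: le_trans; exact: ler0n.
Qed.

Lemma bsum_mono r s : (r <= s <= p)%N -> bsum r <= bsum s.
Proof.
move=> /andP[rs sp]; rewrite -subr_ge0 -(subnKC rs).
by apply: le_trans (@bsum_step r (s - r) _); rewrite ?subnKC.
Qed.

Lemma bsum_le : bsum p <= p%:R * (5 / 4).
Proof.
rewrite mulr_natl -[p in X in _ <= X]card_ord -sumr_const.
by apply: ler_sum => i _; apply: b_le54.
Qed.

Context (rho : R).
Hypothesis rho4 : 4 <= rho.

(* The sequence a; the period is n = p + 1. *)
Definition pseq (k : nat) : R := rho ^+ (k %/ p.+1) * b (k %% p.+1).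

(* S_k / a_{k+d+1} when p + 1 divides k + d + 1. *)
Definition profile (d : nat) : R :=
  1 + rho^-1 * bsum p + (1 - rho^-1) * bsum (p - d).

Lemma pseqE M r : (r <= p)%N -> pseq (M * p.+1 + r) = rho ^+ M * b r.
Proof.
by move=> rp; rewrite /pseq divnMDl // modnMDl divn_small // modn_small // addn0.
Qed.

Lemma pseq_period k : pseq (k + p.+1) = rho * pseq k.
Proof. by rewrite /pseq divnDr // divnn modnDr addn1 exprS mulrA. Qed.

Lemma wsum_pseq M r : (r <= p)%N ->
  wsum p.+1 pseq (M * p.+1 + r) =
  rho ^+ M * (bsum p + rho + (rho - 1) * bsum r).
Proof.
elim: r => [|r IHr] rp.
  rewrite addn0 /wsum big_ord_recr /= -mulSnr -[(M.+1 * _)%N]addn0 pseqE //.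
  rewrite b0 /bsum big_ord0 exprS.
  under eq_bigr => i _ do rewrite pseqE //.
  by rewrite -mulr_sumr; ring.
rewrite addnS wsumS IHr ?(ltnW rp) // -addnS.
rewrite (_ : _ + r + _ = M * p.+1 + r.+1 + p.+1)%N; last by lia.
rewrite pseq_period pseqE //.
rewrite /bsum [in RHS]big_ord_recr /=; ring.
Qed.

Lemma pseq_ge0 k : 0 <= pseq k.
Proof.
have r4 := rho4.
have r0 : 0 <= rho by lra.
have kp : (k %% p.+1 <= p)%N by rewrite -ltnS ltn_mod.
by rewrite mulr_ge0 ?exprn_ge0 // (le_trans ler01 (b_ge1 kp)).
Qed.

Lemma pseqS k : pseq k <= pseq k.+1.
Proof.
have r4 := rho4.
rewrite (divn_eq k p.+1); set M := (k %/ p.+1)%N; set r := (k %% p.+1)%N.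
have rp : (r <= p)%N by rewrite -ltnS ltn_mod.
have rM : 0 <= rho ^+ M by rewrite exprn_ge0 //; lra.
rewrite pseqE //; case: (ltnP r p) => rp'.
  by rewrite -addnS pseqE // ler_wpM2l ?bS.
have -> : r = p by lia.
rewrite -addnS -mulSnr -[(_ * _)%N]addn0 pseqE // b0 exprSr -mulrA ler_wpM2l //.
by have := @b_le54 p (leqnn p); lra.
Qed.

Lemma pseq_growth k : k.+1%:R ^+ 2 <= p.+1%:R ^+ 2 * pseq k.
Proof.
have r4 := rho4.
have sq4 j : (j.+1%:R : R) ^+ 2 <= 4 ^+ j.
  rewrite -!natrX ler_nat; elim: j => // j IHj; rewrite [leqRHS]expnS.
  by apply: leq_trans (leq_mul (leqnn 4) IHj); rewrite -!mulnn; nia.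
set M := (k %/ p.+1)%N.
apply: (@le_trans _ _ ((p.+1 * M.+1)%:R ^+ 2)).
  rewrite -!natrX ler_nat leq_exp2r //.
  have := divn_eq k p.+1; have : (k %% p.+1 < p.+1)%N by rewrite ltn_mod.
  by rewrite -/M; move: (k %% p.+1)%N => r; nia.
rewrite natrM exprMn ler_wpM2l ?sqr_ge0 //; apply: le_trans (sq4 M) _.
apply: (@le_trans _ _ (rho ^+ M)); first by rewrite lerXn2r ?nnegrE //; lra.
rewrite /pseq -/M ler_peMr ?exprn_ge0 //; first by lra.
by rewrite b_ge1 // -ltnS ltn_mod.
Qed.

Lemma profile_bounds d : 1 <= profile d <= p.+1%:R * (5 / 4).
Proof.
have r4 := rho4.
have r0 : 0 < rho^-1 by rewrite invr_gt0; lra.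
have r1 : rho^-1 <= 1 by rewrite invf_le1; lra.
have B0 := @bsum_ge0 p (leqnn p).
have B1 := @bsum_ge0 (p - d) (leq_subr d p).
have B2 : bsum (p - d) <= bsum p by rewrite bsum_mono // leqnn leq_subr.
have H1 : 0 <= rho^-1 * bsum p by rewrite mulr_ge0 // ltW.
have H2 : 0 <= (1 - rho^-1) * bsum (p - d) by rewrite mulr_ge0 // subr_ge0.
have H3 : (1 - rho^-1) * bsum (p - d) <= (1 - rho^-1) * bsum p.
  by rewrite ler_wpM2l // subr_ge0.
have := bsum_le; rewrite /profile -[p.+1%:R]natr1.
by move: (p%:R) => P BP; apply/andP; split; lra.
Qed.

Lemma profile_gap d i : (i <= p)%N -> profile d * (b i - 1) <= 5 / 16.
Proof.
have r4 := rho4.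
move=> ip; have /andP[f1 f2] := profile_bounds d.
have bi := b_le ip; have bi1 := b_ge1 ip.
have n0 : 0 < p.+1%:R :> R by [].
apply: (@le_trans _ _ ((p.+1%:R * (5 / 4)) * (4 * p.+1%:R)^-1)).
  by apply: ler_pM; rewrite ?subr_ge0 ?lerBlDl // (le_trans ler01).
by rewrite le_eqVlt; apply/orP; left; apply/eqP; field; lra.
Qed.

Lemma profile_scale d : rho * profile d =
  bsum p + rho + (rho - 1) * bsum (p - d).
Proof. by have r4 := rho4; rewrite /profile; field; lra. Qed.

Lemma profile_le d k : (d <= p)%N ->
  profile d * pseq (k + d.+1) <= wsum p.+1 pseq k.
Proof.
have r4 := rho4.
move=> dp; rewrite (divn_eq k p.+1).
set M := (k %/ p.+1)%N; set s := (k %% p.+1)%N.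
have sp : (s <= p)%N by rewrite -ltnS ltn_mod.
have rM : 0 <= rho ^+ M by rewrite exprn_ge0 //; lra.
rewrite wsum_pseq // -addnA; case: (leqP (s + d.+1) p) => sd.
  rewrite pseqE // mulrCA ler_wpM2l //.
  have := profile_gap d sd; have Bs := bsum_ge0 sp.
  have r0 : 0 < rho^-1 by rewrite invr_gt0; lra.
  have r1 : rho^-1 <= 1 by rewrite invf_le1; lra.
  have B0 := @bsum_ge0 p (leqnn p).
  have B1 := @bsum_ge0 (p - d) (leq_subr d p).
  have B2 : bsum (p - d) <= bsum p by rewrite bsum_mono // leqnn leq_subr.
  have : profile d <= 1 + bsum p by rewrite /profile; nra.
  nra.
have [r rE] : exists r, (s + d.+1 = p.+1 + r)%N.
  by exists (s + d.+1 - p.+1)%N; lia.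
have rp : (r <= p)%N by lia.
have sE : s = (p - d + r)%N by lia.
rewrite rE addnA -mulSnr pseqE // exprSr.
rewrite (_ : profile d * _ = rho ^+ M * (rho * profile d * b r)); last by ring.
apply: ler_wpM2l => //; case: (posnP r) => [r0|r0].
  by rewrite r0 b0 mulr1 profile_scale sE r0 addn0.
have gap := profile_gap d rp.
have gap' : rho * (profile d * (b r - 1)) <= rho * (5 / 16).
  by rewrite ler_wpM2l //; lra.
have step : 1 <= bsum s - bsum (p - d).
  by rewrite sE; apply: le_trans (bsum_step _); [rewrite ler1n | lia].
have step' : (rho - 1) * 1 <= (rho - 1) * (bsum s - bsum (p - d)).
  by rewrite ler_wpM2l //; lra.
by have := profile_scale d; lra.
Qed.

Theorem periodic_direction : exists u : 'rV[R]_p.+2, norm2 u = 1 /\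
  forall d, (d <= p)%N -> phibar d.+1 u = (1 + profile d)^-1.
Proof.
have r4 := rho4.
have [] := @phibar_regular R p.+1 pseq (p.+1%:R ^+ 2) _ _ pseqS pseq_growth.
- by [].
- exact: pseq_ge0.
move=> u [u1 H]; exists u; split=> // d dp.
have /andP[f1 _] := profile_bounds d.
have f0 : 0 < 1 + profile d by lra.
apply: H => //.
- by rewrite invr_ge0 ltW //= invf_le1 //; lra.
- move=> k; rewrite mulrC ler_pdivlMr //.
  by have := profile_le k dp; lra.
move=> N; exists (N * p.+1 + (p - d))%N; first by nia.
rewrite wsum_pseq ?leq_subr // -profile_scale.
rewrite (_ : (_ + _ + d.+1)%N = (N.+1 * p.+1 + 0)%N); last by lia.
rewrite pseqE // b0 exprSr; field; lra.
Qed.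

End Periodic.

(** * Zariski density *)

Lemma poly_eq0_near0 (R : realType) (q : {poly R}) (e : R) :
  0 < e -> (forall t, `|t| < e -> q.[t] = 0) -> q = 0.
Proof.
move=> e0 qe; apply/eqP; apply: contrapT => /negP q0.
pose f (i : nat) : R := e / i.+2%:R.
have := max_poly_roots (rs := [seq f i | i <- iota 0 (size q)]) q0.
rewrite size_map size_iota ltnn; move=> H; suff : false by []; apply: H.
  apply/allP => _ /mapP[i _ ->]; apply/eqP/qe.
  rewrite ger0_norm ?divr_ge0 ?(ltW e0) // ltr_pdivrMr // ltr_pMr //.
  by rewrite ltr1n.
rewrite map_inj_uniq ?iota_uniq // => i j /(mulfI _) H.
have /invr_inj/eqP : i.+2%:R^-1 = j.+2%:R^-1 :> R by apply: H; rewrite gt_eqF.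
by rewrite eqr_nat => /eqP [].
Qed.

Lemma digits_inj (n D : nat) (f g : 'I_n -> nat) :
  (forall i, f i < D)%N -> (forall i, g i < D)%N ->
  (\sum_i f i * D ^ i = \sum_i g i * D ^ i)%N -> f =1 g.
Proof.
elim: n f g => [|n IHn] f g fD gD; first by move=> _ [].
rewrite !big_ord_recl !expn0 !muln1.
have shift (h : 'I_n.+1 -> nat) : (\sum_(i < n) h (lift ord0 i) *
    D ^ lift ord0 i = (\sum_(i < n) h (lift ord0 i) * D ^ i) * D)%N.
  by rewrite big_distrl; apply: eq_bigr => i _; rewrite lift0 expnSr mulnA.
rewrite !shift => E.
have D0 : (0 < D)%N by apply: leq_ltn_trans (fD ord0).
have f0 : f ord0 = g ord0.
  have := congr1 (modn^~ D) E; rewrite /= ![(f _ + _)%N]addnC ![(g _ + _)%N]addnC.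
  by rewrite !modnMDl !modn_small.
have E' : (\sum_(i < n) f (lift ord0 i) * D ^ i =
    \sum_(i < n) g (lift ord0 i) * D ^ i)%N.
  by move: E; rewrite f0 => /addnI/eqP; rewrite eqn_pmul2r // => /eqP.
have H := IHn _ _ (fun i => fD _) (fun i => gD _) E'.
by move=> i; case: (unliftP ord0 i) => [j ->|->].
Qed.

(* Kronecker substitution [X_i = t ^ (D ^ i)] reduces to one variable. *)
Lemma meval_eq0 (R : realType) (n : nat) (P : mpoly.mpoly n R) :
  (forall v : 'I_n -> R, mpoly.meval v P = 0) -> P = 0.
Proof.
move=> P0.
pose D := mpoly.msize P.
pose key (m : mpoly.multinom n) := (\sum_i m i * D ^ i)%N.
pose Q : {poly R} := \sum_(m <- mpoly.msupp P) mpoly.mcoeff m P *: 'X^(key m).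
have Q0 : Q = 0.
  apply: (@poly_eq0_near0 R Q 1 ltr01) => t _.
  rewrite -[RHS](P0 (fun i => t ^+ (D ^ i))) mpoly.mevalE horner_sum.
  apply: eq_bigr => m _; rewrite hornerZ hornerXn; congr (_ * _).
  by rewrite /key expr_sum; apply: eq_bigr => i _; rewrite -exprM mulnC.
have lt_D m i : m \in mpoly.msupp P -> (m i < D)%N.
  move=> /mpoly.msize_mdeg_lt; apply: leq_ltn_trans.
  by rewrite mpoly.mdegE (bigD1 i) //= leq_addr.
apply/mpoly.mpolyP => m; rewrite mpoly.mcoeff0.
case: (boolP (m \in mpoly.msupp P)) => [mP|/mpoly.memN_msupp_eq0 //].
have := congr1 (fun q : {poly R} => q`_(key m)) Q0.
rewrite coef0 coef_sum (bigD1_seq m) //= ?mpoly.msupp_uniq // big1_seq.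
  by rewrite coefZ coefXn eqxx mulr1 addr0.
move=> m' /andP[m'm m'P]; rewrite coefZ coefXn.
case: eqP => [keq|_]; last by rewrite mulr0.
case/eqP: m'm; apply/mpoly.mnmP => i.
exact: (@digits_inj n D (fun j => m' j) (fun j => m j)
  (fun j => lt_D m' j m'P) (fun j => lt_D m j mP) (esym keq) i).
Qed.

Lemma mpoly_eq0_lines (R : realType) (n : nat) (P : mpoly.mpoly n R)
    (y : 'I_n -> R) :
  (forall v : 'I_n -> R, \forall t \near 0,
    mpoly.meval (fun i => y i + t * v i) P = 0) -> P = 0.
Proof.
move=> H; apply: meval_eq0 => w.
pose v i := w i - y i.
pose Q : {poly R} := \sum_(m <- mpoly.msupp P) mpoly.mcoeff m P *:
  \prod_i ((y i)%:P + v i *: 'X) ^+ m i.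
have QE t : Q.[t] = mpoly.meval (fun i => y i + t * v i) P.
  rewrite mpoly.mevalE horner_sum; apply: eq_bigr => m _.
  rewrite hornerZ horner_prod; congr (_ * _); apply: eq_bigr => i _.
  by rewrite horner_exp hornerD hornerZ hornerC hornerX [v i * t]mulrC.
have /nbhs_ballP[e /= e0 He] := H v.
have Q0 : Q = 0.
  apply: (@poly_eq0_near0 R Q e e0) => t te; rewrite QE; apply: He.
  by rewrite /ball /= sub0r normrN.
have := QE 1; rewrite Q0 horner0 => /esym <-.
by apply: mpoly.meval_eq => i; rewrite mul1r /v addrC subrK.
Qed.

(* Solves [y d = (1 + profile d)^-1] for [rho] and the [b i]: profile 0 is
   1 + bsum p, profile p is 1 + bsum p / rho, and consecutive differences of
   the profile are multiples of the [b i]. *)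
Lemma profile_inverse (R : realType) (p : nat) (y : nat -> R) :
  (0 < p)%N ->
  let f d := (y d)^-1 - 1 in
  let s := (f p - 1) / (f 0 - 1) in
  0 < f 0 - 1 -> 0 < s <= 4^-1 -> 1 - s <= f p.-1 - f p ->
  (forall i, (i.+1 < p)%N ->
     f (p - i.+1)%N - f (p - i)%N <= f (p - i.+2)%N - f (p - i.+1)%N) ->
  f 0 - f 1 <= (1 - s) * (1 + (4 * p.+1%:R)^-1) ->
  exists u : 'rV[R]_p.+2, norm2 u = 1 /\
    forall d, (d <= p)%N -> phibar d.+1 u = y d.
Proof.
move=> p0 f s f0 /andP[s0 s4] f1 f2 f3.
have s1 : 0 < 1 - s by lra.
pose b i : R :=
  if i is j.+1 then (f (p - j.+1)%N - f (p - j)%N) / (1 - s) else 1.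
have bS i : (i < p)%N -> b i <= b i.+1.
  case: i => [|i] ip /=; first by rewrite subn1 subn0 ler_pdivlMr ?mul1r.
  by rewrite ler_pM2r ?invr_gt0 //; exact: f2.
have bp : b p <= 1 + (4 * p.+1%:R)^-1.
  suff -> : b p = (f 0 - f 1) / (1 - s) by rewrite ler_pdivrMr // mulrC.
  rewrite -[in b p](prednK p0) /= prednK // subnn.
  by rewrite (_ : (p - p.-1 = 1)%N); last by lia.
have rho4 : 4 <= s^-1 by rewrite -[4]invrK lef_pV2 ?posrE ?invr_gt0.
have [u [u1 H]] := periodic_direction (b := b) erefl bS bp rho4.
exists u; split=> // d dp; rewrite H //.
have bsumE r : (r <= p)%N -> bsum b r = (f (p - r)%N - f p) / (1 - s).
  elim: r => [|r IHr] rp; first by rewrite /bsum big_ord0 subn0 subrr mul0r.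
  rewrite /bsum big_ord_recr /= -/(bsum b r) IHr ?(ltnW rp) // -mulrDl.
  by congr (_ / _); rewrite addrC addrA subrK.
suff -> : 1 + profile p b s^-1 d = (y d)^-1 by rewrite invrK.
have fp : f p - 1 = s * (f 0 - 1) by rewrite /s divfK // gt_eqF.
rewrite /profile invrK !bsumE ?leq_subr // subnn subKn //.
have -> : (y d)^-1 = f d + 1 by rewrite /f subrK.
have -> : f p = 1 + s * (f 0 - 1) by rewrite -fp addrC subrK.
by field; rewrite gt_eqF.
Qed.

Lemma cvg_affine_inv (R : realType) (y v : R) : y != 0 ->
  ((y + t * v)^-1 - 1) @[t --> (0 : R)] --> y^-1 - 1.
Proof.
move=> y0; apply: cvgB; last exact: cvg_cst.
apply: cvgV => //; rewrite -[X in _ --> X]addr0; apply: cvgD.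
  exact: cvg_cst.
rewrite -[X in _ --> X](mul0r v); apply: cvgMr_tmp; exact: cvg_id.
Qed.

Lemma profile_step (R : realType) (p : nat) (b : nat -> R) (rho : R) (i : nat) :
  (i < p)%N -> profile p b rho (p - i.+1) - profile p b rho (p - i) =
  (1 - rho^-1) * b i.+1.
Proof.
move=> ip; rewrite /profile !subKn ?(ltnW ip) //.
by rewrite {2}/bsum big_ord_recr /= -/(bsum b i); ring.
Qed.

Lemma spectrum_interior (R : realType) (p : nat) : (0 < p)%N ->
  exists y : 'I_p.+1 -> R, forall v : 'I_p.+1 -> R, \forall t \near 0,
    exists u : 'rV[R]_p.+2, norm2 u = 1 /\
      forall i : 'I_p.+1, phibar i.+1 u = y i + t * v i.
Proof.
move=> p0.
pose k : R := (4 * p.+1%:R)^-1; pose h := k / (2 * p.+1%:R).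
have p10 : 0 < p.+1%:R :> R by [].
have k0 : 0 < k by rewrite invr_gt0 mulr_gt0.
have h0 : 0 < h by rewrite divr_gt0 // mulr_gt0.
have hk : p%:R * h + h = k / 2.
  by rewrite /h -[p.+1%:R]natr1; field; rewrite natr1 gt_eqF.
have ph0 : 0 <= p%:R * h by rewrite mulr_ge0 // ltW.
pose b i : R := 1 + i%:R * h.
pose F := profile p b 8.
have bS i : (i < p)%N -> b i <= b i.+1.
  by move=> _; rewrite /b -natr1; lra.
have bp : b p <= 1 + (4 * p.+1%:R)^-1.
  by rewrite -/k /b; lra.
have b0 : b 0 = 1 by rewrite /b mul0r addr0.
have r4 : 4 <= 8 :> R by lra.
have Fge1 d : 1 <= F d by case/andP: (profile_bounds b0 bS bp r4 d).
have F0E : F 0 = 1 + bsum b p.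
  by rewrite /F /profile subn0; field.
have FpE : F p = 1 + bsum b p / 8.
  by rewrite /F /profile subnn {2}/bsum big_ord0; field.
have Bp : 0 < bsum b p.
  apply: lt_le_trans (_ : p%:R <= _); first by rewrite ltr0n.
  have := bsum_step b0 bS bp (leqnn (0 + p)).
  by rewrite add0n {2}/bsum big_ord0 subr0.
have FS i : (i < p)%N -> F (p - i.+1)%N - F (p - i)%N = 7 / 8 * b i.+1.
  by move=> ip; rewrite /F profile_step //; congr (_ * _); field.
pose y d := (1 + F d)^-1.
have F1 d : 1 + F d != 0 by have := Fge1 d; lra.
exists (fun i => y i) => v.
pose vv d := v (inord d).
pose f t d := (y d + t * vv d)^-1 - 1.
have cf d : f t d @[t --> (0 : R)] --> F d.
  have -> : F d = (y d)^-1 - 1 by rewrite /y invrK addrAC subrr add0r.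
  by apply: cvg_affine_inv; rewrite invr_eq0.
have cs : (f t p - 1) / (f t 0 - 1) @[t --> (0 : R)] --> (8^-1 : R).
  have -> : 8^-1 = (F p - 1) / (F 0 - 1).
    by rewrite FpE F0E; field; lra.
  apply: cvgM; first by apply: cvgB; [exact: cf | exact: cvg_cst].
  apply: cvgV; first by rewrite F0E; lra.
  by apply: cvgB; [exact: cf | exact: cvg_cst].
pose e := Num.min (h / 10) (bsum b p / 2).
have e0 : 0 < e by rewrite lt_min !divr_gt0.
have h10 : 0 < h / 10 by rewrite divr_gt0.
have nf : \forall t \near (0 : R), forall d : 'I_p.+1, `|F d - f t d| < e.
  have nd (d : 'I_p.+1) : \forall t \near (0 : R), `|F d - f t d| < e.
    exact: cvgr_dist_lt (cf d) _ e0.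
  exact: (@filter_forall R _ _ _ (nbhs_filter (0 : R)) nd).
have ns : \forall t \near (0 : R), `|8^-1 - (f t p - 1) / (f t 0 - 1)| < h / 10.
  exact: cvgr_dist_lt cs _ h10.
apply: filterS2 nf ns => t Hf.
have ft d : (d <= p)%N -> F d - h / 10 < f t d < F d + h / 10.
  move=> dp; have := Hf (inord d).
  by rewrite inordK // lt_min => /andP[+ _]; rewrite ltr_norml; lra.
have f00 : 0 < f t 0 - 1.
  by have := Hf ord0; rewrite lt_min => /andP[_]; rewrite ltr_norml /= F0E; lra.
rewrite ltr_norml; move sE : ((f t p - 1) / (f t 0 - 1)) => s /andP[s1 s2].
have k1 : k <= 1.
  by rewrite invf_le1 ?mulr_gt0 // -natrM ler1n.
have h1 : h <= 1 by lra.
have [|||||u [u1 Hu]] := @profile_inverse R p (fun d => y d + t * vv d) p0.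
- exact: f00.
- by rewrite -/(f t p) -/(f t 0) sE; lra.
- rewrite -/(f t p) -/(f t 0) -/(f t p.-1) sE.
  have := FS 0%N p0; rewrite subn1 subn0 /b.
  have := ft p (leqnn p); have := ft p.-1 (leq_pred p); lra.
- move=> i ip; rewrite -/(f t _) -/(f t (p - i)%N) -/(f t (p - i.+2)%N).
  have := FS i (ltnW ip); have := FS i.+1 ip; rewrite /b -[i.+2%:R]natr1.
  have := ft _ (leq_subr i p); have := ft _ (leq_subr i.+1 p).
  by have := ft _ (leq_subr i.+2 p); lra.
- rewrite -/(f t p) -/(f t 0) -/(f t 1) -/k sE.
  have p1 : (p.-1 < p)%N by rewrite (prednK p0).
  have := FS p.-1 p1; rewrite (prednK p0) subnn.
  rewrite (_ : (p - p.-1)%N = 1%N); last by rewrite -{1}(prednK p0) subSnn.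
  rewrite /b; have := ft 0%N (leq0n p); have := ft 1%N p0.
  have : (7 / 8 - h / 10) * (1 + k) <= (1 - s) * (1 + k).
    by rewrite ler_pM2r //; lra.
  have : h * k <= h by rewrite ler_piMr // ltW.
  lra.
by exists u; split=> // i; rewrite Hu ?leq_ord // /vv inord_val.
Qed.

Theorem theorem6 (R : realType) (n : nat) (hn : (3 <= n)%N) :
  ~ (exists P : mpoly.mpoly n R,
       P <> 0 /\
       forall u : 'rV[R]_n.+1, norm2 u = 1 ->
         mpoly.meval (fun i : 'I_n => phibar i.+1 u) P = 0).
Proof.
case: n hn => // p hp [P [P0 HP]]; apply: P0.
have p0 : (0 < p)%N by lia.
have [y Hy] := @spectrum_interior R p p0.
apply: (@mpoly_eq0_lines R p.+1 P y) => v.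
apply: filterS (Hy v) => t [u [u1 Hu]].
by rewrite -[RHS](HP u u1); apply: mpoly.meval_eq => i; rewrite Hu.
Qed.
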